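(* Let $c\in\mathbb{R}$ and $r\in\mathbb{N}$, and let $\mathbb{D}$ be the space of real-valued càdlàg functions on $[0,1]$ with the $J_1$-metric $d$. The mappings $\phi_r,\varphi_r:\mathbb{D}\to\mathbb{R}$, $$\phi_r(\xi)=\sup_{t\in[0,1]}\big\{\xi(t)-ct-\mathfrak{J}^r_\xi(t)\big\},\qquad \varphi_r(\xi)=\sup_{t\in[0,1]}\big\{\xi(t)-ct-(r+1)\mathfrak{J}^r_\xi(t)+r\,\mathfrak{J}^{r+1}_\xi(t)\big\},$$ are Lipschitz continuous with respect to $J_1$. More precisely, there exist $K\in[0,|c|+2r+1]$ and $L\in[0,|c|+4r^2+4r+1]$ such that $|\phi_r(\xi)-\phi_r(\zeta)|\le K\,d(\xi,\zeta)$ and $|\varphi_r(\xi)-\varphi_r(\zeta)|\le L\,d(\xi,\zeta)$ for all $\xi,\zeta\in\mathbb{D}$.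
   Context: The $J_1$-metric is $d(\xi,\zeta)=\inf_{h\in\Lambda}\{\|h-id\|\vee\|\xi-\zeta\circ h\|\}$, where $\Lambda$ is the set of all strictly increasing continuous bijections of $[0,1]$ to itself, $id$ is the identity mapping, and $\|\cdot\|$ is the sup norm on $[0,1]$. For $\xi\in\mathbb{D}$ and $m\in\mathbb{N}=\{1,2,\dots\}$, $$\mathfrak{J}^m_\xi(t)=\sup\Big\{\sum_{i=1}^m\big(\xi(s_i)-\xi(s_i^-)\big):\ (s_1,\dots,s_m)\in[0,t]^m,\ s_i\ne s_j\ \text{for } i\neq j\Big\},\quad t\in(0,1],$$ and $\mathfrak{J}^m_\xi(0)=0$, with $\xi(s^-)$ the left limit of $\xi$ at $s$ and the convention $\xi(0^-)=\xi(0)$. *)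

(* Defs.v *)
From HB Require Import structures.
From mathcomp Require Import all_boot all_order all_algebra.
From mathcomp Require Import all_classical all_reals all_analysis.
From mathcomp Require Import lra.

Set Implicit Arguments.
Unset Strict Implicit.
Unset Printing Implicit Defensive.

Import Order.TTheory GRing.Theory Num.Theory.
Import numFieldNormedType.Exports.

Local Open Scope classical_set_scope.
Local Open Scope ring_scope.

(* A function on [0, 1] is represented by a total function R -> R; every
   definition below depends only on its values on [0, 1]. *)
Section Skorokhod.
Context {R : realType}.
Implicit Types (xi zeta h f : R -> R) (m r : nat) (c s t : R).

Definition cadlag : set (R -> R) := [set xi : R -> R |
  (forall t, 0 <= t < 1 -> xi x @[x --> t^'+] --> xi t) /\
  (forall t, 0 < t <= 1 -> cvg (xi x @[x --> t^'-]))].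

Definition left_limit xi s : R :=
  if s == 0 then xi 0 else lim (xi x @[x --> s^'-]).

Definition jump xi s : R := xi s - left_limit xi s.

Definition sup_norm f : R := sup [set `|f t| | t in `[0, 1]].

Definition time_change : set (R -> R) := [set h : R -> R |
  [/\ {in `[0, 1] &, {homo h : s t / s < t}},
      {within `[0, 1], continuous h} &
      set_bij `[0, 1] `[0, 1] h]].

Definition J1_dist xi zeta : R :=
  inf [set Num.max (sup_norm (fun t => h t - t))
                   (sup_norm (fun t => xi t - zeta (h t)))
      | h in time_change].

Definition jump_sums m xi t : set R :=
  [set \sum_(i < m) jump xi (s i) |
    s in [set s : 'I_m -> R | (forall i, s i \in `[0, t]) /\ injective s]].

Definition max_jumps m xi t : R :=
  if t == 0 then 0 else sup (jump_sums m xi t).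

Definition phi c r xi : R :=
  sup [set xi t - c * t - max_jumps r xi t | t in `[0, 1]].

Definition varphi c r xi : R :=
  sup [set xi t - c * t - r.+1%:R * max_jumps r xi t
           + r%:R * max_jumps r.+1 xi t | t in `[0, 1]].

(* In a realType, sup and inf are total and return 0 when there is no finite
   supremum or infimum.  The lemmas below show that this default value is never
   used above for cadlag arguments. *)

Lemma cadlag_bounded xi : cadlag xi ->
  exists M, forall t, t \in `[0, 1] -> `|xi t| <= M.
Proof.
move=> [rc ll].
pose P (M x : R) := x \in `[0, 1] -> `|xi x| <= M.
have loc t : t \in `[0, 1] -> exists M, \forall x \near t, P M x.
  rewrite in_itv /= => /andP[t0 t1].
  have [Mr HMr] : exists M, \forall x \near t^'+, P M x.
    have [t1'|t1'] := ltP t 1.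
      exists (`|xi t| + 1).
      have /rc xit : 0 <= t < 1 by rewrite t0.
      near=> x => _; near: x.
      exact: cvgr_norm_le _ xit _ (ltr_pwDr ltr01 (lexx `|xi t|)).
    exists 0; near=> x.
    have tx : t < x by near: x; exact: nbhs_right_gt.
    rewrite /P in_itv /= => /andP[_ x1].
    by exfalso; lra.
  have [Ml HMl] : exists M, \forall x \near t^'-, P M x.
    have [t0'|t0'] := ltP 0 t.
      exists (`|lim (xi x @[x --> t^'-])| + 1).
      have /ll xit : 0 < t <= 1 by rewrite t0'.
      near=> x => _; near: x.
      exact: cvgr_norm_le _ xit _ (ltr_pwDr ltr01 (lexx `|lim (xi x @[x --> t^'-])|)).
    exists 0; near=> x.
    have tx : x < t by near: x; exact: nbhs_left_lt.
    rewrite /P in_itv /= => /andP[x0 _].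
    by exfalso; lra.
  exists (Num.max `|xi t| (Num.max Mr Ml)).
  move: HMr HMl; rewrite /at_right /at_left /within /= => HMr HMl.
  near=> x.
  have [tx|xt|<-] := ltgtP t x; rewrite /P => x01.
  - have : P Mr x by move: tx; near: x.
    by move=> /(_ x01); rewrite !le_max => ->; rewrite ?orbT.
  - have : P Ml x by move: xt; near: x.
    by move=> /(_ x01); rewrite !le_max => ->; rewrite ?orbT.
  - by rewrite le_max lexx.
have /compact_near_coveringP cK := @segment_compact R 0 1.
have [|M [_ HM]] := cK R (pinfty_nbhs R) P _.
  move=> t /= /loc[M HM].
  near=> y => /=.
  have yt : P M y.1.
    near: y; exists ([set x | P M x], setT) => /=.
      by split => //; exact: filterT.
    by case=> a b [].
  have yM : M <= y.2.
    near: y; exists (setT, [set x | M <= x]) => /=.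
      by split; [exact: filterT | exact: nbhs_pinfty_ge (num_real _)].
    by case=> a b [].
  by move=> /yt /le_trans; apply.
exists (M + 1) => t t01; apply: (HM (M + 1)) => //.
by rewrite ltrDl.
Unshelve. all: by end_near.
Qed.

Lemma left_limit_bounded xi M s : cadlag xi ->
  (forall t, t \in `[0, 1] -> `|xi t| <= M) ->
  s \in `[0, 1] -> `|left_limit xi s| <= M.
Proof.
move=> [_ ll] HM; rewrite in_itv /= => /andP[s0 s1].
rewrite /left_limit; case: eqVneq => [_|sn0].
  by apply: HM; rewrite in_itv /= lexx ler01.
have sp : 0 < s by rewrite lt_neqAle eq_sym sn0.
have /ll cs : 0 < s <= 1 by rewrite sp.
have near_s : \forall x \near s^'-, `|xi x| <= M.
  near=> x; apply: HM; rewrite in_itv /=; apply/andP; split.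
    by near: x; exact: nbhs_left_ge.
  by apply: le_trans s1; near: x; exact: nbhs_left_le.
rewrite ler_norml; apply/andP; split.
  by apply: limr_ge => //; apply: filterS near_s => x; rewrite ler_norml => /andP[].
by apply: limr_le => //; apply: filterS near_s => x; rewrite ler_norml => /andP[].
Unshelve. all: by end_near.
Qed.

Lemma cadlag_jump_bounded xi : cadlag xi ->
  exists M, forall t, t \in `[0, 1] -> `|jump xi t| <= M.
Proof.
move=> cxi; have [M HM] := cadlag_bounded cxi.
exists (M + M) => t t01; rewrite (le_trans (ler_normB _ _))// lerD ?HM//.
exact: left_limit_bounded HM t01.
Qed.

Lemma jump_sums_neq0 m xi t : 0 < t -> jump_sums m xi t !=set0.
Proof.
move=> t0; exists (\sum_(i < m) jump xi (t / i.+1%:R)).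
exists (fun i : 'I_m => t / i.+1%:R) => //; split=> [i|i j /= ij].
  have t0' := ltW t0; rewrite in_itv /= divr_ge0 ?ler0n//=.
  by rewrite ler_pdivrMr ?ltr0n// ler_peMr// ler1n.
move: ij => /(mulfI (lt0r_neq0 t0)) /invr_inj /eqP.
by rewrite eqr_nat eqSS => /eqP /val_inj.
Qed.

Lemma jump_sums_bounded m xi : cadlag xi ->
  exists M, 0 <= M /\ forall t, t \in `[0, 1] -> forall x, jump_sums m xi t x -> `|x| <= M.
Proof.
move=> /cadlag_jump_bounded[M HM].
have M0 : 0 <= M.
  by rewrite (le_trans (normr_ge0 _) (HM 0 _))// in_itv /= lexx ler01.
exists (\sum_(i < m) M); split; first exact: sumr_ge0.
move=> t; rewrite in_itv /= => /andP[t0 t1] _ [s [st _] <-].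
rewrite (le_trans (ler_norm_sum _ _ _))//; apply: ler_sum => i _.
apply: HM; have := st i; rewrite !in_itv /= => /andP[-> st1] /=.
exact: le_trans st1 t1.
Qed.

Lemma has_sup_jump_sums m xi t : cadlag xi -> 0 < t <= 1 ->
  has_sup (jump_sums m xi t).
Proof.
move=> cxi /andP[t0 t1]; split; first exact: jump_sums_neq0.
have [M [_ HM]] := jump_sums_bounded m cxi.
exists M => x /HM xM; rewrite (le_trans (ler_norm _))// xM//.
by rewrite in_itv /= ltW.
Qed.

Lemma max_jumps_bounded m xi : cadlag xi ->
  exists M, forall t, t \in `[0, 1] -> `|max_jumps m xi t| <= M.
Proof.
move=> cxi; have [M [M0 HM]] := jump_sums_bounded m cxi.
exists M => t t01; rewrite /max_jumps; case: eqVneq => [_|tn0].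
  by rewrite normr0.
have : 0 <= t <= 1 by move: t01; rewrite in_itv.
move=> /andP[t0 t1].
have tp : 0 < t by rewrite lt_neqAle eq_sym tn0.
have tp1 : 0 < t <= 1 by rewrite tp.
have hs := has_sup_jump_sums m cxi tp1.
have [x jx] := hs.1.
rewrite ler_norml; apply/andP; split.
  apply: (@le_trans _ _ x); last exact: sup_upper_bound.
  by have := HM _ t01 _ jx; rewrite ler_norml => /andP[].
by apply: ge_sup; [exists x|move=> y /(HM _ t01); rewrite ler_norml => /andP[]].
Qed.

Lemma has_sup_image01 f M : (forall t, t \in `[0, 1] -> f t <= M) ->
  has_sup [set f t | t in `[0, 1]].
Proof.
move=> fM; split; first by exists (f 0), 0 => //=; rewrite in_itv /= lexx ler01.
by exists M => _ [t t01 <-]; exact: fM.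
Qed.

Lemma has_sup_sup_norm_time h : time_change h ->
  has_sup [set `|h t - t| | t in `[0, 1]].
Proof.
move=> [_ _ [hf _ _]]; apply: (@has_sup_image01 _ 1) => t t01.
have := hf t t01; move: t01; rewrite /= !in_itv /= => /andP[? ?] /andP[? ?].
by rewrite ler_norml; apply/andP; split; lra.
Qed.

Lemma has_sup_sup_norm_space xi zeta h : cadlag xi -> cadlag zeta ->
  time_change h -> has_sup [set `|xi t - zeta (h t)| | t in `[0, 1]].
Proof.
move=> /cadlag_bounded[M HM] /cadlag_bounded[N HN] [_ _ [hf _ _]].
apply: (@has_sup_image01 _ (M + N)) => t t01.
by rewrite (le_trans (ler_normB _ _))// lerD ?HM// HN//; exact: hf.
Qed.

Lemma has_inf_J1_dist xi zeta : has_inf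
  [set Num.max (sup_norm (fun t => h t - t))
               (sup_norm (fun t => xi t - zeta (h t)))
  | h in time_change].
Proof.
split.
  exists (Num.max (sup_norm (fun t => id t - t))
                  (sup_norm (fun t => xi t - zeta (id t)))), id => //.
  split; [by [] | by apply: continuous_subspaceT => x; exact: cvg_id |].
  by split; [move=> t | move=> t u _ _ | move=> t t01; exists t].
exists 0 => _ [h hT <-]; rewrite le_max; apply/orP; left.
apply: le_trans (sup_upper_bound (has_sup_sup_norm_time hT) _); last first.
  by exists 0 => //=; rewrite in_itv /= lexx ler01.
exact: normr_ge0.
Qed.

Lemma has_sup_phi c r xi : cadlag xi ->
  has_sup [set xi t - c * t - max_jumps r xi t | t in `[0, 1]].
Proof.
move=> cxi; have [M HM] := cadlag_bounded cxi.
have [N HN] := max_jumps_bounded r cxi.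
apply: (@has_sup_image01 _ (M + `|c| + N)) => t t01.
have ct : `|c * t| <= `|c|.
  rewrite normrM; move: t01; rewrite in_itv /= => /andP[t0 t1].
  by rewrite (ger0_norm t0) ler_piMr.
rewrite (le_trans (ler_norm _))// (le_trans (ler_normB _ _))//.
by rewrite lerD ?HN// (le_trans (ler_normB _ _))// lerD ?HM.
Qed.

Lemma has_sup_varphi c r xi : cadlag xi ->
  has_sup [set xi t - c * t - r.+1%:R * max_jumps r xi t
               + r%:R * max_jumps r.+1 xi t | t in `[0, 1]].
Proof.
move=> cxi; have [M HM] := cadlag_bounded cxi.
have [N HN] := max_jumps_bounded r cxi.
have [Q HQ] := max_jumps_bounded r.+1 cxi.
apply: (@has_sup_image01 _ (M + `|c| + r.+1%:R * N + r%:R * Q)) => t t01.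
have ct : `|c * t| <= `|c|.
  rewrite normrM; move: t01; rewrite in_itv /= => /andP[t0 t1].
  by rewrite (ger0_norm t0) ler_piMr.
rewrite (le_trans (ler_norm _))// (le_trans (ler_normD _ _))//.
rewrite lerD//; last by rewrite normrM normr_nat ler_wpM2l// HQ.
rewrite (le_trans (ler_normB _ _))// lerD//; last first.
  by rewrite normrM normr_nat ler_wpM2l// HN.
by rewrite (le_trans (ler_normB _ _))// lerD ?HM.
Qed.

End Skorokhod.

(* Main.v *)
Require Import Defs.
From mathcomp Require Import all_boot all_order all_algebra.
From mathcomp Require Import all_classical all_reals all_analysis.
From mathcomp Require Import ring lra.

Set Implicit Arguments.
Unset Strict Implicit.
Unset Printing Implicit Defensive.

Import Order.TTheory GRing.Theory Num.Theory.
Import numFieldNormedType.Exports.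

Local Open Scope classical_set_scope.
Local Open Scope ring_scope.

(** Fix a time change [h] and let [e] bound both [|h t - t|] and
    [|xi t - zeta (h t)|] on the unit interval.  The left limit of [xi] at [s]
    is within [e] of that of [zeta] at [h s], because [h x] increases to [h s]
    as [x] increases to [s]; hence corresponding jumps differ by at most [2 e]
    ([jump_time_change]).  Since [h] also matches the families of [m] distinct
    times in [[0, t]] with those in [[0, h t]], the two suprema of sums of [m]
    jumps differ by at most [2 m e] ([max_jumps_time_change]).

    Consequently the function of [t] whose supremum is [phi c r xi] differs at
    [t] from the one for [zeta] at [h t] by at most
    [e + |c| e + 2 r e], and for [varphi] by at most
    [e + |c| e + (r + 1) (2 r e) + r (2 (r + 1) e)].  As [h] is onto, the same
    bounds hold between the suprema, and the infimum over [h] turns [e] into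
    the distance.  Thus [K] and [L] can be taken equal to the upper ends of
    their prescribed ranges. *)

Section TimeChange.
Context {R : realType}.
Implicit Types (xi zeta h f g : R -> R) (m r : nat) (c e s t : R).

Lemma dist_sup_le (A B : set R) e : has_sup A -> has_sup B ->
  (forall a, A a -> exists2 b, B b & `|a - b| <= e) ->
  (forall b, B b -> exists2 a, A a & `|a - b| <= e) ->
  `|sup A - sup B| <= e.
Proof.
move=> hA hB AB BA.
have leA : sup A <= sup B + e.
  apply: ge_sup => [|a /AB[b /(sup_upper_bound hB)]]; first exact: hA.1.
  by rewrite ler_norml => ? /andP[? ?]; lra.
have leB : sup B <= sup A + e.
  apply: ge_sup => [|b /BA[a /(sup_upper_bound hA)]]; first exact: hB.1.
  by rewrite ler_norml => ? /andP[? ?]; lra.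
by rewrite ler_norml; apply/andP; split; lra.
Qed.

(** * Time changes as order isomorphisms of the unit interval *)

Lemma time_change_in01 h t : time_change h -> t \in `[0, 1] -> h t \in `[0, 1].
Proof. by move=> [_ _ [hf _ _]] t01; exact: hf. Qed.

Lemma time_change_surj h u : time_change h -> u \in `[0, 1] ->
  exists2 t, t \in `[0, 1] & h t = u.
Proof. by move=> [_ _ [_ _ hs]] u01; have [t] := hs u u01; exists t. Qed.

Lemma time_change_le h : time_change h ->
  {in `[0, 1] &, {mono h : s t / s <= t}}.
Proof. by move=> [hlt _ _]; exact: le_mono_in. Qed.

Lemma time_change_lt h : time_change h ->
  {in `[0, 1] &, {mono h : s t / s < t}}.
Proof. by move=> /time_change_le hle; exact: leW_mono_in. Qed.

Lemma time_change_inj h : time_change h -> {in `[0, 1] &, injective h}.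
Proof. by move=> /time_change_le hle; exact: inc_inj_in. Qed.

Lemma time_change0 h : time_change h -> h 0 = 0.
Proof.
move=> hT; have z01 : (0 : R) \in `[0, 1] by rewrite in_itv /= lexx ler01.
apply/eqP; rewrite eq_le; apply/andP; split; last first.
  by have := time_change_in01 hT z01; rewrite in_itv /= => /andP[].
have [t t01 ht0] := time_change_surj hT z01.
rewrite -[leRHS]ht0 time_change_le//.
by move: t01; rewrite in_itv /= => /andP[].
Qed.

Lemma time_change_eq0 h t : time_change h -> t \in `[0, 1] ->
  (h t == 0) = (t == 0).
Proof.
move=> hT t01; apply/eqP/eqP => [ht0|->]; last exact: time_change0.
apply: (time_change_inj hT) => //; first by rewrite in_itv /= lexx ler01.
by rewrite ht0 time_change0.
Qed.

(** Every left neighbourhood of [h s] contains some [u] below [h s] such that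
    the whole of [`]u, h s[] lies in it; the preimage of [u] starts a left
    neighbourhood of [s] which [h] maps into [`]u, h s[]. *)
Lemma time_change_cvg_left h s : time_change h -> s \in `[0, 1] -> s != 0 ->
  h x @[x --> s^'-] --> (h s)^'-.
Proof.
move=> hT s01 sn0.
have hs01 := time_change_in01 hT s01.
have hsn0 : h s != 0 by rewrite time_change_eq0.
move=> P [d /= d0 dP].
have /andP[hs0 hs1] : 0 <= h s <= 1 by move: hs01; rewrite in_itv.
have hsp : 0 < h s by rewrite lt_neqAle eq_sym hsn0.
(* the cutoff at 0 keeps this point in the range of h *)
pose u := Num.max 0 (h s - d).
have u01 : u \in `[0, 1].
  by rewrite in_itv /= /u le_max lexx ge_max ler01 /=; lra.
have us : u < h s by rewrite /u gt_max hsp /=; lra.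
have [v v01 vu] := time_change_surj hT u01.
have vs : v < s by rewrite -(time_change_lt hT)// vu.
rewrite /nbhs /=; near=> x.
have vx : v < x by near: x; exact: nbhs_left_gt.
have xs : x < s by near: x; exact: nbhs_left_lt.
have x01 : x \in `[0, 1].
  by move: v01 s01; rewrite !in_itv /= => /andP[? ?] /andP[? ?]; lra.
have hxs : h x < h s by rewrite time_change_lt.
have uhx : u < h x by rewrite -vu time_change_lt.
apply: dP => //=.
have : h s - d < h x by apply: le_lt_trans uhx; rewrite /u le_max lexx orbT.
by rewrite gtr0_norm; lra.
Unshelve. all: by end_near.
Qed.

(** * Jumps of two paths that a time change brings close *)

Section Close.
Variables (xi zeta h : R -> R) (e : R).
Hypotheses (cxi : cadlag xi) (czeta : cadlag zeta) (hT : time_change h).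
Hypothesis close : forall t, t \in `[0, 1] -> `|xi t - zeta (h t)| <= e.

Lemma left_limit_time_change s : s \in `[0, 1] ->
  `|left_limit xi s - left_limit zeta (h s)| <= e.
Proof.
move=> s01; rewrite /left_limit time_change_eq0//.
have z01 : (0 : R) \in `[0, 1] by rewrite in_itv /= lexx ler01.
case: eqVneq => [s0|sn0]; first by rewrite -{2}(time_change0 hT); exact: close.
have /andP[s0 s1] : 0 <= s <= 1 by move: s01; rewrite in_itv.
have /andP[hs0 hs1] : 0 <= h s <= 1.
  by have := time_change_in01 hT s01; rewrite in_itv.
have sp : 0 < s by rewrite lt_neqAle eq_sym sn0.
have hsp : 0 < h s by rewrite lt_neqAle eq_sym time_change_eq0// sn0.
have cx : cvg (xi x @[x --> s^'-]) by apply: cxi.2; rewrite sp.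
have cz : cvg (zeta x @[x --> (h s)^'-]) by apply: czeta.2; rewrite hsp.
have czh : zeta (h x) @[x --> s^'-] --> lim (zeta x @[x --> (h s)^'-]).
  exact: cvg_comp (time_change_cvg_left hT s01 sn0) cz.
have cD : `|xi x - zeta (h x)| @[x --> s^'-] -->
    `|lim (xi x @[x --> s^'-]) - lim (zeta x @[x --> (h s)^'-])|.
  by apply: cvg_norm; apply: cvgB.
rewrite -(cvg_lim _ cD)//; apply: limr_le; first exact: cvgP cD.
near=> x; apply: close; rewrite in_itv /=; apply/andP; split.
  by near: x; exact: nbhs_left_ge.
by apply: le_trans s1; near: x; exact: nbhs_left_le.
Unshelve. all: by end_near.
Qed.

Lemma jump_time_change s : s \in `[0, 1] ->
  `|jump xi s - jump zeta (h s)| <= 2 * e.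
Proof.
move=> s01; rewrite /jump; have := close s01; have := left_limit_time_change s01.
rewrite !ler_norml => /andP[? ?] /andP[? ?].
by apply/andP; split; lra.
Qed.

Lemma jump_sum_time_change m (s : 'I_m -> R) : (forall i, s i \in `[0, 1]) ->
  `|\sum_(i < m) jump xi (s i) - \sum_(i < m) jump zeta (h (s i))|
    <= 2 * m%:R * e.
Proof.
move=> s01; rewrite -sumrB (le_trans (ler_norm_sum _ _ _))//.
rewrite (le_trans (ler_sum _ (fun i _ => jump_time_change (s01 i))))//.
by rewrite sumr_const card_ord -[leLHS]mulr_natr mulrAC.
Qed.

Lemma max_jumps_time_change m t : t \in `[0, 1] ->
  `|max_jumps m xi t - max_jumps m zeta (h t)| <= 2 * m%:R * e.
Proof.
move=> t01; rewrite /max_jumps time_change_eq0//.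
have e0 : 0 <= e by exact: le_trans (normr_ge0 _) (close t01).
case: eqVneq => [_|tn0].
  by rewrite subrr normr0 !mulr_ge0.
have /andP[t0 t1] : 0 <= t <= 1 by move: t01; rewrite in_itv.
have ht01 := time_change_in01 hT t01.
have /andP[ht0 ht1] : 0 <= h t <= 1 by move: ht01; rewrite in_itv.
have tp : 0 < t by rewrite lt_neqAle eq_sym tn0.
have htp : 0 < h t by rewrite lt_neqAle eq_sym time_change_eq0// tn0.
have z01 : (0 : R) \in `[0, 1] by rewrite in_itv /= lexx ler01.
apply: dist_sup_le => [| |_ [s [st sinj] <-]|_ [u [ut uinj] <-]].
- by apply: has_sup_jump_sums => //; rewrite tp.
- by apply: has_sup_jump_sums => //; rewrite htp.
- have s01 i : s i \in `[0, 1].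
    by have := st i; rewrite !in_itv /= => /andP[-> /le_trans->].
  exists (\sum_(i < m) jump zeta (h (s i))); last exact: jump_sum_time_change.
  exists (h \o s) => //; split=> [i|i j /= /(time_change_inj hT)].
    have := st i; rewrite !in_itv /= => /andP[si0 sit].
    by rewrite -{1}(time_change0 hT) !time_change_le// si0.
  by move=> /(_ (s01 i) (s01 j)) /sinj.
- have /choice[s hs] i : exists s, s \in `[0, 1] /\ h s = u i.
    have [|s s01 su] := @time_change_surj h (u i) hT; last by exists s.
    by have := ut i; rewrite !in_itv /= => /andP[-> /le_trans->].
  have s01 i := (hs i).1.
  have uE : u = h \o s by apply/funext => i; rewrite /= (hs i).2.
  exists (\sum_(i < m) jump xi (s i)); last by rewrite uE; exact: jump_sum_time_change.
  exists s => //; split=> [i|i j sij].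
    have := ut i; rewrite uE !in_itv /= => /andP[_].
    by rewrite time_change_le// => ->; have := s01 i; rewrite in_itv /= => /andP[->].
  by apply: uinj; rewrite uE /= sij.
Qed.

Hypothesis close_id : forall t, t \in `[0, 1] -> `|h t - t| <= e.

Lemma drift_time_change c t : t \in `[0, 1] ->
  `|(xi t - c * t) - (zeta (h t) - c * h t)| <= (`|c| + 1) * e.
Proof.
move=> t01.
have -> : xi t - c * t - (zeta (h t) - c * h t) =
          c * (h t - t) + (xi t - zeta (h t)) by ring.
rewrite (le_trans (ler_normD _ _))// mulrDl mul1r lerD ?close// normrM.
by rewrite ler_wpM2l// close_id.
Qed.

End Close.

(** * From a single time change to the distance *)

(** It suffices to compare along each time change separately, with the larger
    of its two distortions in place of the distance. *)
Lemma lipschitz_J1 (F : (R -> R) -> R) (K : R) xi zeta : 0 < K ->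
  cadlag xi -> cadlag zeta ->
  (forall h e, time_change h ->
    (forall t, t \in `[0, 1] -> `|xi t - zeta (h t)| <= e) ->
    (forall t, t \in `[0, 1] -> `|h t - t| <= e) ->
    `|F xi - F zeta| <= K * e) ->
  `|F xi - F zeta| <= K * J1_dist xi zeta.
Proof.
move=> K0 cxi czeta FK; rewrite -ler_pdivrMl//.
apply: lb_le_inf; first exact: (has_inf_J1_dist xi zeta).1.
move=> _ [h hT <-]; rewrite ler_pdivrMl//; apply: (FK h) => // t t01.
  rewrite le_max; apply/orP; right.
  by apply: (sup_upper_bound (has_sup_sup_norm_space cxi czeta hT)); exists t.
rewrite le_max; apply/orP; left.
by apply: (sup_upper_bound (has_sup_sup_norm_time hT)); exists t.
Qed.

Lemma dist_sup_time_change f g h e : time_change h ->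
  has_sup [set f t | t in `[0, 1]] -> has_sup [set g t | t in `[0, 1]] ->
  (forall t, t \in `[0, 1] -> `|f t - g (h t)| <= e) ->
  `|sup [set f t | t in `[0, 1]] - sup [set g t | t in `[0, 1]]| <= e.
Proof.
move=> hT hf hg fg; apply: dist_sup_le => // [_ [t t01 <-]|_ [u u01 <-]].
  by exists (g (h t)); [exists (h t) => //; exact: time_change_in01 | exact: fg].
have [t t01 <-] := time_change_surj hT u01.
by exists (f t); [exists t | exact: fg].
Qed.

Lemma phi_lipschitz c r xi zeta : cadlag xi -> cadlag zeta ->
  `|phi c r xi - phi c r zeta| <= (`|c| + 2 * r%:R + 1) * J1_dist xi zeta.
Proof.
move=> cxi czeta; apply: (@lipschitz_J1 (phi c r)) => // h e hT close close_id.
apply: (@dist_sup_time_change _ _ h) => // [||t t01].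
    exact: has_sup_phi.
  exact: has_sup_phi.
have := drift_time_change close close_id c t01.
have := max_jumps_time_change cxi czeta hT close r t01.
by rewrite !ler_norml => /andP[? ?] /andP[? ?]; apply/andP; split; lra.
Qed.

Lemma varphi_lipschitz c r xi zeta : cadlag xi -> cadlag zeta ->
  `|varphi c r xi - varphi c r zeta|
    <= (`|c| + 4 * r%:R ^+ 2 + 4 * r%:R + 1) * J1_dist xi zeta.
Proof.
move=> cxi czeta; apply: (@lipschitz_J1 (varphi c r)) => // h e hT close close_id.
apply: (@dist_sup_time_change _ _ h) => // [||t t01].
    exact: has_sup_varphi.
  exact: has_sup_varphi.
set J := max_jumps r xi t; set J' := max_jumps r zeta (h t).
set Q := max_jumps r.+1 xi t; set Q' := max_jumps r.+1 zeta (h t).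
have -> : xi t - c * t - r.+1%:R * J + r%:R * Q -
    (zeta (h t) - c * h t - r.+1%:R * J' + r%:R * Q') =
    (xi t - c * t - (zeta (h t) - c * h t)) -
    r.+1%:R * (J - J') + r%:R * (Q - Q') by ring.
have -> : (`|c| + 4 * r%:R ^+ 2 + 4 * r%:R + 1) * e =
    (`|c| + 1) * e + r.+1%:R * (2 * r%:R * e) + r%:R * (2 * r.+1%:R * e).
  by rewrite -natr1; ring.
rewrite (le_trans (ler_normD _ _))// lerD//; last first.
  by rewrite normrM normr_nat ler_wpM2l// max_jumps_time_change.
rewrite (le_trans (ler_normB _ _))// lerD//; first exact: drift_time_change.
by rewrite normrM normr_nat ler_wpM2l// max_jumps_time_change.
Qed.

End TimeChange.

Theorem lemma3p3 (R : realType) (c : R) (r : nat) (r_gt0 : (0 < r)%N) :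
  exists K L : R,
    [/\ 0 <= K <= `|c| + 2 * r%:R + 1,
        0 <= L <= `|c| + 4 * r%:R ^+ 2 + 4 * r%:R + 1 &
        forall xi zeta : R -> R, cadlag xi -> cadlag zeta ->
          `|phi c r xi - phi c r zeta| <= K * J1_dist xi zeta /\
          `|varphi c r xi - varphi c r zeta| <= L * J1_dist xi zeta].
Proof.
exists (`|c| + 2 * r%:R + 1), (`|c| + 4 * r%:R ^+ 2 + 4 * r%:R + 1).
split=> [||xi zeta cxi czeta].
- by rewrite lexx andbT !addr_ge0// mulr_ge0.
- by rewrite lexx andbT !addr_ge0// mulr_ge0// exprn_ge0.
- by split; [exact: phi_lipschitz | exact: varphi_lipschitz].
Qed.
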